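(* Let $(\mathbf{E},\|\cdot\|)$ be a finite-dimensional real normed space with dual norm $\|\cdot\|_*$, and let $\mathcal{X}\supseteq \mathcal{B}_{\|\cdot\|}$ be a closed and convex subset of $\mathbf{E}$ containing the unit ball $\mathcal{B}_{\|\cdot\|}$. Let $K\ge 1$ be an integer and $\kappa\ge 0$. Suppose there exist a positive integer $M$, independent random vectors $\mathbf{z}^1,\ldots,\mathbf{z}^M$ supported on the dual unit ball $\mathcal{B}_{\|\cdot\|_*}$, and reals $\varepsilon>0$, $\alpha>0$, $0<\gamma<1/2$, such that, with $\bar\delta=16\sqrt{\frac{\ln(MK/\gamma)}{\alpha}}$, the following hold: (a) $(\mathbf{E},\|\cdot\|)$ is $(\kappa,\eta,r,\mu)$-locally smoothable, with $\mu>0$, $0<r\leq\bar\delta/8$, and $\eta\leq\varepsilon\mu/4$; (b) $\mathbb{P}\big[\inf_{\lambda\in\Delta_M}\big\|\sum_{i=1}^M\lambda_i\mathbf{z}^i\big\|_*\leq 4\mu\varepsilon\big]\leq\gamma$; (c) for any $i\in\{1,\dots,M\}$, $x\in\mathcal{B}_{\|\cdot\|}$ and $\delta>0$, $\mathbb{P}[\langle\mathbf{z}^i,x\rangle\geq\delta]\leq\exp\{-\alpha\delta^2\}$ and $\mathbb{P}[\langle\mathbf{z}^i,x\rangle\leq-\delta]\leq\exp\{-\alpha\delta^2\}$; (d) $\bar\delta\leq\mu\varepsilon/M$. Then, for any local oracle, the high probability complexity of the class $\mathcal{F}^{\kappa}_{(\mathbf{E},\|\cdot\|)}(1)$ on $\mathcal{X}$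 satisfies $$\mathrm{Compl}_{\mathrm{HP}}^{2\gamma}\big(\mathcal{F}^{\kappa}_{(\mathbf{E},\|\cdot\|)}(1),\mathcal{X},K,\varepsilon\big)\geq M.$$
   Context: Notation. $\Delta_M=\{\lambda\in\mathbb{R}^M:\lambda_i\ge0,\sum_i\lambda_i=1\}$; $\mathcal{B}_{\|\cdot\|}(x,r)$ is the ball of center $x$ and radius $r$, and $\mathcal{B}_{\|\cdot\|}=\mathcal{B}_{\|\cdot\|}(0,1)$; $\langle\cdot,\cdot\rangle$ is the duality pairing between $\mathbf{E}^*$ and $\mathbf{E}$. Function classes. For $\mu>0$, $\mathcal{F}^{\kappa}_{(\mathbf{E},\|\cdot\|)}(\mu)$ is the class of convex functions $f:\mathbf{E}\to\mathbb{R}$ such that: if $\kappa=0$, $\|g_x-g_y\|_*\le\mu$ for all $x,y\in\mathbf{E}$ and all subgradients $g_x\in\partial f(x)$, $g_y\in\partial f(y)$; if $\kappa>0$, $f$ is $\lceil\kappa\rceil$ times differentiable and $\|D^{\lceil\kappa\rceil}f(y)-D^{\lceil\kappa\rceil}f(x)\|_{\mathrm{op}}\le\mu\|y-x\|^{\kappa+1-\lceil\kappa\rceil}$ for all $x,y\in\mathbf{E}$, where $D^t f$ is the $t$-th derivative (a symmetric $t$-linear form) and $\|A\|_{\mathrm{op}}=\sup_{\|h\|\le1}|A[h;\ldots;h]|$. (So $0<\kappa\le1$ means $\|\nabla f(y)-\nabla f(x)\|_*\le\mu\|y-x\|^\kappa$, and $\kappa=2$ means $\mu$-Lipschitz Hessian.)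 Local smoothability. $(\mathbf{E},\|\cdot\|)$ is $(\kappa,\eta,r,\mu)$-locally smoothable if there is a map $\mathcal{S}:\mathcal{F}^0_{(\mathbf{E},\|\cdot\|)}(1)\to\mathcal{F}^\kappa_{(\mathbf{E},\|\cdot\|)}(\mu)$ such that (i) $\|f-\mathcal{S}f\|_\infty\le\eta$ for every $f$; and (ii) if $f,g\in\mathcal{F}^0_{(\mathbf{E},\|\cdot\|)}(1)$ and $x\in\mathbf{E}$ are such that $f$ and $g$ coincide on $\mathcal{B}_{\|\cdot\|}(x,2r)$, then $\mathcal{S}f$ and $\mathcal{S}g$ coincide on $\mathcal{B}_{\|\cdot\|}(x,r)$. Oracle model. For a class $\mathcal{F}$ of convex functions on $\mathbf{E}$ and a feasible set $\mathcal{X}$, an $\varepsilon$-solution for $f\in\mathcal{F}$ is an $x\in\mathcal{X}$ with $f(x)-\inf_{\mathcal{X}}f\le\varepsilon$. An oracle $\mathcal{O}$ returns an answer $\mathcal{O}_f(x)$ for each $f\in\mathcal{F}$, $x\in\mathcal{X}$; it is local if $\mathcal{O}_f(x)=\mathcal{O}_g(x)$ whenever $f\equiv g$ in a neighborhood of $x$. A $K$-parallel deterministic algorithm works in rounds; in round $t$ it queries a batch $X^t=\{x_1^t,\ldots,x_K^t\}\subseteq\mathcal{X}$ and receives $\mathcal{O}_f(X^t)=(\mathcal{O}_f(x^t_1),\ldots,\mathcal{O}_f(x^t_K))$, where $X^1$ is fixed in advance and $X^{t+1}=U^{t+1}(X^1,\mathcal{O}_f(X^1),\ldots,X^t,\mathcal{O}_f(X^t))$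 for deterministic functions $U^{t+1}$. $\mathcal{A}^K(\mathcal{O})$ is the set of such algorithms, and $T(A,f,\varepsilon)$ is the minimum number of rounds for algorithm $A$ run on $f$ to find (query) an $\varepsilon$-solution. With $\Delta(\mathcal{F})$ the set of probability distributions over $\mathcal{F}$, for $\gamma\in(0,1)$, $$\mathrm{Compl}_{\mathrm{HP}}^{\gamma}(\mathcal{F},\mathcal{X},K,\varepsilon)=\sup_{F\in\Delta(\mathcal{F})}\ \inf_{A\in\mathcal{A}^K(\mathcal{O})}\ \inf\{\tau:\ \mathbb{P}_{f\sim F}[T(A,f,\varepsilon)\le\tau]\ge\gamma\}.$$ *)

(* Defs.v *)
From HB Require Import structures.
From mathcomp Require Import all_boot all_order all_algebra.
From mathcomp Require Import all_classical all_reals all_analysis.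

Set Implicit Arguments.
Unset Strict Implicit.
Unset Printing Implicit Defensive.

Import Order.TTheory GRing.Theory Num.Theory.
Import numFieldNormedType.Exports.

Local Open Scope classical_set_scope.
Local Open Scope ring_scope.

(* Finite-dimensional normed spaces. *)
#[short(type="normedVectType")]
HB.structure Definition NormedVector (R : numFieldType) :=
  {E of NormedModule R E & Vector R E}.

(* Generators of the coarsest sigma-algebra on [S] that makes [ev ^~ x]
   measurable for every [x]. *)
Definition eval_sets (R : realType) (E S : Type) (ev : S -> E -> R) :
    set (set S) :=
  [set C | exists x : E, exists2 B : set R,
     measurable B & C = [set s | B (ev s x)]].

Section Dual.
Context {R : realType}.
Implicit Type E : normedVectType R.

(* All linear forms are continuous, since [E] is finite-dimensional. *)
Definition dual E := 'Hom(E, R^o).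

Definition pairing E (l : dual E) (x : E) : R := l x.

HB.instance Definition _ E := GRing.Lmodule.on (dual E).
HB.instance Definition _ E := isPointed.Build (dual E) 0.

(* In finite dimension this is the Borel sigma-algebra of the dual space. *)
Definition dual_salgebra E : set (set (dual E)) :=
  <<s eval_sets (@pairing E) >>.

HB.instance Definition _ E :=
  @isMeasurable.Build (sigma_display (eval_sets (@pairing E))) (dual E)
    (@dual_salgebra E) (@sigma_algebra0 _ setT _) (@sigma_algebraC _ _)
    (@sigma_algebra_bigcup _ setT _).

Definition cball E (x : E) (r : R) : set E := closed_ball_ Num.norm x r.

Definition dual_norm E (l : dual E) : \bar R :=
  ereal_sup [set (pairing l x)%:E | x in cball (0 : E) 1].

Definition simplex (M : nat) : set ('I_M -> R) :=
  [set w | (forall i, 0 <= w i) /\ \sum_(i < M) w i = 1].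

End Dual.

Arguments simplex {R} M.

Definition mutually_independent d d' (Omega : measurableType d)
    (T : measurableType d') (R : realType) (P : probability Omega R) (M : nat)
    (X : 'I_M -> {RV P >-> T}) :=
  forall (J : {set 'I_M}) (B : 'I_M -> set T), (forall i, measurable (B i)) ->
  P [set w | forall i, i \in J -> B i (X i w)]
  = (\prod_(i in J) P [set w | B i (X i w)])%E.

Section FunctionClasses.
Context {R : realType} {E : normedVectType R}.
Implicit Types (f g : E -> R) (x y h : E) (k : nat).

Definition subgradient f x : set (dual E) :=
  [set l | forall y, f x + pairing l (y - x) <= f y].

(* [iter_diff f [:: h_1; ...; h_k] x] is D^k f(x)[h_1; ...; h_k]. *)
Fixpoint iter_diff f (hs : seq E) : E -> R :=
  if hs is h :: hs' then fun x => 'd (iter_diff f hs' : E -> R^o) x h else f.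

(* Frechet differentiability of each D^j f, j < k, as a map into the space of
   j-linear forms; as this space has finite dimension, it is equivalent to
   the differentiability of all the maps x |-> D^j f(x)[h_1; ...; h_j]. *)
Definition times_differentiable k f :=
  forall hs : seq E, (size hs < k)%N ->
  forall x, differentiable (iter_diff f hs : E -> R^o) x.

(* The operator norm of a symmetric form given by its diagonal values. *)
Definition opnorm (A : E -> R) : \bar R :=
  ereal_sup [set `|A h|%:E | h in cball (0 : E) 1].

Definition smooth_class (kappa mu : R) : set (E -> R) :=
  [set f |
    convex_function [set: convex_lmodType E] (f : convex_lmodType E -> R^o) /\
    if kappa == 0 then
      forall x y (gx gy : dual E), subgradient f x gx -> subgradient f y gy ->
        (dual_norm (gx - gy)%R <= mu%:E)%E
    else
      let k := `|Num.ceil kappa|%N in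
      times_differentiable k f /\
      forall x y,
        (opnorm (fun h => (iter_diff f (nseq k h) y
                           - iter_diff f (nseq k h) x)%R)
         <= (mu * `|y - x| `^ (kappa + 1 - k%:R))%:E)%E].

Definition locally_smoothable (kappa eta r mu : R) :=
  exists S : (E -> R) -> (E -> R),
    [/\ forall f, smooth_class 0 1 f -> smooth_class kappa mu (S f),
        forall f, smooth_class 0 1 f -> forall x, `|f x - S f x| <= eta &
        forall f g x, smooth_class 0 1 f -> smooth_class 0 1 g ->
          {in cball x (2 * r), f =1 g} -> {in cball x r, S f =1 S g}].

End FunctionClasses.

Section OracleModel.
Context {R : realType} {E : normedVectType R}.
Variables (F : set (E -> R)) (X : set E).

Definition eps_solution (eps : R) (f : E -> R) : set E :=
  [set x | X x /\ ((f x)%:E - ereal_inf [set (f y)%:E | y in X] <= eps%:E)%E].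

Definition local_oracle (Ans : Type) (O : (E -> R) -> E -> Ans) :=
  forall f g x, F f -> F g -> X x ->
    (\forall y \near x, f y = g y) -> O f x = O g x.

Section Algorithms.
Variables (K : nat) (Ans : Type) (O : (E -> R) -> E -> Ans).

Definition batch := 'I_K -> E.
(* The batches queried so far and their answers, in chronological order. *)
Definition transcript := seq (batch * ('I_K -> Ans)).

(* An algorithm maps the transcript of the first [t] rounds to the batch of
   round [t + 1]; its value at [[::]] is the batch fixed in advance. *)
Definition algorithms : set (transcript -> batch) :=
  [set A | forall tr k, X (A tr k)].

Fixpoint run (A : transcript -> batch) (f : E -> R) (t : nat) : transcript :=
  if t is t'.+1 then
    let tr := run A f t' in rcons tr (A tr, fun k => O f (A tr k))
  else [::].

(* +oo when no round finds an [eps]-solution. *)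
Definition rounds (A : transcript -> batch) (f : E -> R) (eps : R) : \bar R :=
  ereal_inf [set t.+1%:R%:E | t in
    [set t : nat | exists k, eps_solution eps f (A (run A f t) k)]].

(* Distributions over [F] are encoded as probability measures on [E -> R] that
   give mass 1 to [F]. The sigma-algebra, generated by the evaluation maps and
   by [F] itself, induces on [F] the one generated by the evaluation maps
   (without adding it, [F] need not be measurable in [E -> R]). *)
Definition class_sets : set (set (E -> R)) :=
  eval_sets (fun (f : E -> R) (x : E) => f x) `|` [set F].

Definition distributions : set (probability (g_sigma_algebraType class_sets) R) :=
  [set D | D F = 1%E].

(* Algorithms and oracles are arbitrary maps, so that the event below may fail
   to be measurable; its probability is then its outer measure, which makes
   the complexity as small as possible. On measurable events [mu_ext D] is [D]. *)
Definition Compl_HP (gamma eps : R) : \bar R :=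
  ereal_sup [set
    ereal_inf [set
      ereal_inf [set tau%:R%:E | tau in
        [set tau : nat | (gamma%:E <=
           mu_ext D [set f : E -> R |
             F f /\ (rounds A f eps <= tau%:R%:E)%E])%E]]
    | A in algorithms]
  | D in distributions].

End Algorithms.
End OracleModel.

(* Main.v *)
(* Choose f_z(x) = 1/2 max (max_i (<z_i, x> - i delta), |x| - 2), smoothed and
   rescaled.  With high probability a query made before round t sees only the
   first t terms of the maximum in a small ball around it: it is chosen
   independently of the later z_i, so by concentration those pairings are too
   small to matter, and outside a ball of radius 5/2 the norm takes over.  By
   locality of the smoothing and of the oracle each round reveals at most one
   new vector, and until all M are revealed the values found are at least about
   - M delta / 2, whereas by minimax the minimum over the unit ball is at most
   - 2 mu eps.

   The smoothing operator is an arbitrary map, so the random function built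
   from z itself need not be measurable.  Hence each z_i is replaced by a
   representative of its cell in a finite partition of the dual unit ball, at
   distance at most delta / 110. *)
Require Import Defs.
From HB Require Import structures.
From mathcomp Require Import all_boot all_order all_algebra.
From mathcomp Require Import all_classical all_reals all_analysis.
From mathcomp Require Import lra ring.
Import Order.TTheory GRing.Theory Num.Theory.
Import numFieldNormedType.Exports.
Local Open Scope classical_set_scope.
Local Open Scope ring_scope.
Set Implicit Arguments.
Unset Strict Implicit.
Unset Printing Implicit Defensive.

(** * Approximate minimax *)

Lemma pairingDr (R : realType) (E : normedVectType R) (l : dual E) x y :
  pairing l (x + y) = pairing l x + pairing l y.
Proof. by rewrite /pairing linearD. Qed.

Lemma pairingZr (R : realType) (E : normedVectType R) (l : dual E) a x :
  pairing l (a *: x) = a * pairing l x.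
Proof. by rewrite /pairing linearZ. Qed.

Lemma pairingNr (R : realType) (E : normedVectType R) (l : dual E) x :
  pairing l (- x) = - pairing l x.
Proof. by rewrite /pairing linearN. Qed.

Lemma pairingBr (R : realType) (E : normedVectType R) (l : dual E) x y :
  pairing l (x - y) = pairing l x - pairing l y.
Proof. by rewrite pairingDr pairingNr. Qed.

Lemma pairing_sumr (R : realType) (E : normedVectType R) (l : dual E) I (s : seq I) P
    (F : I -> E) :
  pairing l (\sum_(i <- s | P i) F i) = \sum_(i <- s | P i) pairing l (F i).
Proof. by rewrite /pairing linear_sum. Qed.

Lemma pairingBl (R : realType) (E : normedVectType R) (l l' : dual E) x :
  pairing (l - l') x = pairing l x - pairing l' x.
Proof. by rewrite /pairing !lfun_simp. Qed.

Lemma pairing_suml (R : realType) (E : normedVectType R) I (s : seq I) P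
    (a : I -> R) (F : I -> dual E) x :
  pairing (\sum_(i <- s | P i) a i *: F i)%R x =
  \sum_(i <- s | P i) a i * pairing (F i) x.
Proof.
rewrite /pairing sum_lfunE; apply: eq_bigr => i _.
by rewrite scale_lfunE.
Qed.

Lemma cball0E (R : realType) (E : normedVectType R) (x : E) r :
  cball 0 r x <-> `|x| <= r.
Proof. by rewrite /cball /closed_ball_ /= sub0r normrN. Qed.

(* Blackwell's approachability argument: answering the weights proportional to
   the positive parts of the cumulated payoffs keeps their square sum linear. *)
Lemma approachability (R : realType) (T : Type) (B : set T) M (g : T -> 'I_M -> R) (b : R) :
  (0 < M)%N ->
  (forall x i, B x -> `|g x i| <= b) ->
  (forall lam, simplex M lam -> exists2 x, B x & \sum_i lam i * g x i <= 0) ->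
  forall n, exists s : seq T, [/\ size s = n, forall x, List.In x s -> B x &
    \sum_i (Num.max 0 (\sum_(x <- s) g x i)) ^+ 2 <= n%:R * (M%:R * b ^+ 2)].
Proof.
move=> M0 gb gl; elim=> [|n [s [sn sB IH]]].
  exists [::]; split => //; rewrite mul0r big1// => i _.
  by rewrite big_nil maxxx expr0n.
pose p i : R := Num.max 0 (\sum_(x <- s) g x i).
have p0 i : 0 <= p i by rewrite le_max lexx.
have [x Bx gx] : exists2 x, B x & \sum_i p i * g x i <= 0.
  (* If all positive parts vanish they cannot be normalised into weights. Every point of [B] then
     works, and a vertex of the simplex provides one. *)
  have [/eqP S0|S0] := eqVneq (\sum_i p i) 0.
    have [|x Bx _] := gl (fun i => (i == Ordinal M0)%:R).
      split=> [i|]; first exact: ler0n.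
      rewrite (bigD1 (Ordinal M0))//= ?eqxx big1 ?addr0// => i /negbTE -> //.
    exists x => //; rewrite big1// => i _.
    rewrite psumr_eq0// in S0.
    by move/allP: S0 => /(_ i (mem_index_enum _))/= /eqP ->; rewrite mul0r.
  have S1 : 0 < \sum_i p i by rewrite lt_neqAle eq_sym S0 sumr_ge0.
  have [|x Bx gx] := gl (fun i => p i / \sum_i p i).
    by split=> [i|]; [rewrite divr_ge0// ltW|rewrite -mulr_suml divff].
  exists x => //; rewrite -(pmulr_rle0 _ (x := (\sum_i p i)^-1)) ?invr_gt0//.
  by rewrite mulr_sumr; under eq_bigr do rewrite mulrA [_^-1 * _]mulrC.
exists (x :: s); split => /=; first by rewrite sn.
  by move=> y [<-//|/sB].
have b2 i : g x i ^+ 2 <= b ^+ 2.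
  by rewrite -real_normK ?num_real// ler_pXn2r// ?nnegrE// ?(le_trans _ (gb x i Bx))// gb.
(* The positive part of a new total is at most [|p i + g x i|]. In the expanded square, the cross
   terms have a nonpositive sum by the choice of [x], so each round adds at most [M * b ^ 2]. *)
apply: (@le_trans _ _ (\sum_i (p i ^+ 2 + 2 * (p i * g x i) + b ^+ 2))).
  apply: ler_sum => i _; rewrite big_cons.
  apply: (@le_trans _ _ ((p i + g x i) ^+ 2)); last first.
    by rewrite sqrrD [2 * _]mulr_natl lerD2l.
  rewrite -[leRHS]real_normK ?num_real// ler_pXn2r ?nnegrE// ?le_max ?lexx//.
  rewrite ge_max normr_ge0/=; apply: le_trans (ler_norm _).
  by rewrite addrC lerD2r le_max lexx orbT.
have IHp : \sum_i p i ^+ 2 <= n%:R * (M%:R * b ^+ 2) := IH.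
rewrite !big_split/= sumr_const card_ord -[b ^+ 2 *+ _]mulr_natl.
rewrite -[n.+1]addn1 natrD [leRHS]mulrDl [1 * (_ * _)]mul1r lerD2r.
by rewrite (le_trans _ IHp)// gerDl -mulr_sumr pmulr_rle0.
Qed.

(** Averages the [n] points that approachability gives for the payoffs [pairing (z i) x + c]. Each
    cumulated payoff is at most the square root of [n * C], so an average payoff is at most that of
    [C / n], and [n] is chosen to bring this below [e]. *)
Lemma approx_minimax (R : realType) (E : normedVectType R) M (z : 'I_M -> dual E) (c b : R) :
  (0 < M)%N ->
  (forall i x, `|x| <= 1 -> `|pairing (z i) x| <= b) ->
  (forall lam, simplex M lam ->
     exists2 x, `|x| <= 1 & \sum_i lam i * pairing (z i) x <= - c) ->
  forall e, 0 < e -> exists2 x, `|x| <= 1 & forall i, pairing (z i) x <= - c + e.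
Proof.
move=> M0 zb zl e e0.
pose C := M%:R * (b + `|c|) ^+ 2.
have C0 : 0 <= C by rewrite mulr_ge0// sqr_ge0.
pose n := (Num.truncn (C / e ^+ 2)).+1.
have nC : C <= n%:R * e ^+ 2.
  by rewrite -ler_pdivrMr ?exprn_gt0// ltW// truncnS_gt.
have n0 : 0 < n%:R :> R by rewrite ltr0n.
have [|lam lamS|s [sn sB sS]] := @approachability R E [set x | `|x| <= 1] M
  (fun x i => pairing (z i) x + c) (b + `|c|) M0 _ _ n.
- by move=> x i /= x1; rewrite (le_trans (ler_normD _ _))// lerD2r zb.
- have [x x1 xc] := zl _ lamS; exists x => //.
  under eq_bigr do rewrite mulrDr.
  by rewrite big_split/= -mulr_suml lamS.2 mul1r -lerBrDr sub0r.
exists (n%:R^-1 *: \sum_(x <- s) x).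
  rewrite normrZ (ger0_norm (x := n%:R^-1)) ?invr_ge0 ?(ltW n0)//.
  rewrite mulrC ler_pdivrMr// mul1r.
  rewrite (le_trans (ler_norm_sum _ _ _))// -sn; elim: s {sn sS} sB => [|y s IH] sB.
    by rewrite big_nil.
  rewrite big_cons -[size _]/(size s).+1 -add1n natrD lerD ?sB//=; first by left.
  by apply: IH => x xs; apply: sB; right.
move=> i; rewrite pairingZr pairing_sumr ler_pdivrMl//.
have : \sum_(x <- s) (pairing (z i) x + c) <= n%:R * e.
  apply: (@le_trans _ _ (Num.max 0 (\sum_(x <- s) (pairing (z i) x + c)))).
    by rewrite le_max lexx orbT.
  rewrite -(@ler_pXn2r _ 2)// ?nnegrE ?le_max ?lexx// ?mulr_ge0 ?(ltW e0)//.
  apply: (@le_trans _ _ (n%:R * C)); last by rewrite exprMn expr2 -mulrA ler_wpM2l.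
  apply: le_trans sS; rewrite (bigD1 i)//= lerDl sumr_ge0// => j _.
  by rewrite sqr_ge0.
rewrite big_split/= big_const_seq count_predT iter_addr_0 sn -mulr_natl; lra.
Qed.

(** * Finite-dimensional normed spaces *)

Section FiniteDimension.
Variables (R : realType) (E : normedVectType R).
Import VectorInternalTheory.

Let e_ (j : 'I_(dim E)) : E := r2v (delta_mx 0 j).

Lemma r2vE (u : 'rV[R]_(dim E)) : r2v u = \sum_j u 0 j *: e_ j.
Proof. by rewrite {1}[u]row_sum_delta linear_sum; apply: eq_bigr => j _; rewrite linearZ. Qed.

Lemma norm_r2v (u : 'rV[R]_(dim E)) (a : R) :
  (forall j, `|u 0 j| <= a) -> `|r2v u| <= a * \sum_j `|e_ j|.
Proof.
move=> ua; rewrite r2vE (le_trans (ler_norm_sum _ _ _))// mulr_sumr ler_sum// => j _.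
by rewrite normrZ ler_wpM2r.
Qed.

Lemma ler_mx_norm_coord m n (u : 'M[R]_(m, n)) i j : `|u i j| <= `|u|.
Proof.
rewrite [leRHS]/Num.Def.normr/= mx_normrE.
by apply/bigmax_geP; right => /=; exists (i, j).
Qed.

Lemma continuous_norm_r2v : continuous (fun u : 'rV[R]_(dim E) => `|r2v u|).
Proof.
move=> u; apply/(@cvgrPdist_le _ _ _ (nbhs u)) => a a0.
pose L := \sum_j `|e_ j|.
have L1 : 0 < L + 1 by rewrite ltr_wpDl// sumr_ge0.
near=> v.
rewrite (le_trans (ler_dist_dist _ _))// -linearB/=.
rewrite (le_trans (norm_r2v (a := `|u - v|) _))//.
  by move=> j; exact: ler_mx_norm_coord.
apply: (@le_trans _ _ ((a / (L + 1)) * (L + 1))); last by rewrite divfK// gt_eqF.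
apply: ler_pM => //; last by rewrite lerDl.
  by rewrite sumr_ge0.
near: v; apply: cvgr_dist_le => //; by rewrite divr_gt0.
Unshelve. all: by end_near. Qed.

(** Equivalence of the norm of [E] with that of coordinates: the norm of [r2v u] has a positive
    minimum on the compact unit sphere of coordinate vectors, and [C] is its inverse. *)
Lemma v2r_bounded : exists2 C : R, 0 < C & forall (x : E) j, `|v2r x 0 j| <= C * `|x|.
Proof.
pose S := [set u : 'rV[R]_(dim E) | `|u| = 1].
have cS : compact S.
  apply: bounded_closed_compact.
    by exists 1; split; [exact: num_real|move=> y y1 u /= ->; exact: ltW].
  apply: (closed_comp (f := fun u : 'rV[R]_(dim E) => `|u|) (D := [set 1])).
    by move=> u _; exact: norm_continuous.
  exact: closed_eq.
have SE x : x != 0 -> S (`|v2r x|^-1 *: v2r x).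
  move=> x0; rewrite /S/= normrZ ger0_norm ?invr_ge0// mulVf// normr_eq0.
  by apply: contra x0 => /eqP; rewrite -(linear0 v2r) => /v2r_inj ->.
(* The sphere is empty only in dimension zero, where every [x] is 0. *)
have [S0|S0] := pselect (S !=set0); last first.
  exists 1 => // x j; have [->|/SE Sx] := eqVneq x 0; last by case: S0; eexists; exact: Sx.
  by rewrite linear0 mxE normr0 mulr_ge0.
have [|u Su uS] := compact_EVT_min S0 cS (f := fun u : 'rV[R]_(dim E) => `|r2v u|).
  exact/continuous_subspaceT/continuous_norm_r2v.
have u0 : 0 < `|r2v u|.
  rewrite normr_gt0; apply/negP => /eqP; rewrite -(linear0 r2v) => /r2v_inj u0.
  by move: Su; rewrite inE /S/= u0 normr0 => /esym/eqP; rewrite oner_eq0.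
exists (`|r2v u|^-1); rewrite ?invr_gt0// => x j.
have [->|x0] := eqVneq x 0.
  by rewrite linear0 mxE !normr0 mulr0.
rewrite (le_trans (ler_mx_norm_coord _ _ _))//.
have := uS _ (mem_set (SE _ x0)).
rewrite linearZ/= v2rK normrZ ger0_norm ?invr_ge0//.
have v0 : 0 < `|v2r x|.
  rewrite normr_gt0; apply: contra x0 => /eqP; rewrite -(linear0 v2r) => /v2r_inj -> //.
by rewrite ler_pdivlMl// mulrC -ler_pdivlMl.
Qed.

Lemma pairing_r2v (l : dual E) (x : E) : pairing l x = \sum_j v2r x 0 j * pairing l (e_ j).
Proof.
by rewrite -{1}[x]v2rK r2vE pairing_sumr; apply: eq_bigr => j _; rewrite pairingZr.
Qed.

Lemma pairing_bounded (l : dual E) : exists2 b : R, 0 <= b & forall x : E, `|pairing l x| <= b * `|x|.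
Proof.
have [C C0 CE] := v2r_bounded.
exists (C * \sum_j `|pairing l (e_ j)|); first by rewrite mulr_ge0 ?(ltW C0)// sumr_ge0.
move=> x; rewrite pairing_r2v (le_trans (ler_norm_sum _ _ _))//.
rewrite mulrAC mulr_sumr ler_sum// => j _.
by rewrite normrM ler_wpM2r.
Qed.

End FiniteDimension.

(** * Finite partition of the dual ball *)

Section DualMeasurability.
Variables (R : realType) (E : normedVectType R).
Import VectorInternalTheory.

Lemma measurable_pairing (x : E) (B : set R) :
  measurable B -> measurable [set l : dual E | B (pairing l x)].
Proof. by move=> mB; apply: sub_sigma_algebra; exists x, B. Qed.

Let e_ (j : 'I_(dim E)) : E := r2v (delta_mx 0 j).

(** Otherwise the first grid point above [a], which is at most [a + h], would separate [a] from
    [a']. The number of grid points ensures that this one is among them. *)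
Lemma grid_close (b h : R) (a a' : R) : 0 < h -> - b <= a <= b -> - b <= a' <= b ->
  (forall m : 'I_((Num.truncn ((b + b) / h)).+2),
     (- b + m%:R * h <= a) = (- b + m%:R * h <= a')) ->
  a' <= a + h.
Proof.
move=> h0 /andP[ba ab] /andP[ba' ab'] aa'; rewrite leNgt; apply/negP => ah.
have mN : ((Num.truncn ((a + b) / h)).+1 < (Num.truncn ((b + b) / h)).+2)%N.
  by rewrite !ltnS le_truncn// ler_pM2r ?invr_gt0// lerD2r.
have ab0 : 0 <= (a + b) / h by rewrite divr_ge0 ?(ltW h0)//; lra.
have /andP[t1 t2] := truncn_itv ab0.
rewrite ler_pdivlMr// in t1; rewrite ltr_pdivrMr// in t2.
move: t1 t2 (aa' (Ordinal mN)) => /=; set tn := Num.truncn _.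
rewrite -natr1 mulrDl mul1r; set t := _%:R * h => t1 t2.
have -> : (- b + (t + h) <= a) = false by apply/negbTE; rewrite -ltNge; lra.
by move=> /esym/negbT; rewrite -ltNge; lra.
Qed.

(* The cells are cut out by finitely many half-spaces, and each of them is
   represented by one of its elements lying in the dual unit ball. *)
Lemma dual_ball_discretization (theta : R) : 0 < theta ->
  exists (V : finType) (cell : dual E -> V) (rep : V -> dual E),
  [/\ forall v, measurable [set l | cell l = v],
      forall v x, `|pairing (rep v) x| <= `|x| &
      forall l, (forall x, `|pairing l x| <= `|x|) ->
        forall x, `|pairing (rep (cell l)) x - pairing l x| <= theta * `|x|].
Proof.
move=> theta0; have [C C0 vC] := v2r_bounded E.
pose b := \sum_j `|e_ j|.
(* Each coordinate of [x] is at most [C * |x|], so an error [h] on every basis vector costs at most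
   [dim E * C * h * |x|]. The successor keeps the denominator positive in dimension zero. *)
pose h := theta / (C * (dim E).+1%:R).
have h0 : 0 < h by rewrite divr_gt0// mulr_gt0.
pose N := (Num.truncn ((b + b) / h)).+2.
pose cell (l : dual E) : {ffun 'I_(dim E) * 'I_N -> bool} :=
  [ffun jm : 'I_(dim E) * 'I_N => - b + jm.2%:R * h <= pairing l (e_ jm.1)].
pose ballD := [set l : dual E | forall x, `|pairing l x| <= `|x|].
(* A cell that misses the dual ball gets the default 0, which also satisfies the norm bound. *)
pose rep v := xget 0 [set l | ballD l /\ cell l = v].
exists {ffun 'I_(dim E) * 'I_N -> bool}, cell, rep; split.
- move=> v.
  rewrite (_ : [set l | _] = \bigcap_(jm in [set: 'I_(dim E) * 'I_N])
    [set l | [set a | (- b + jm.2%:R * h <= a) = v jm] (pairing l (e_ jm.1))]).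
    apply: fin_bigcap_measurable => // jm _; apply: measurable_pairing.
    case: (v jm).
      rewrite (_ : [set _ | _] = `[- b + jm.2%:R * h, +oo[%classic) //.
      by apply/seteqP; split => a /=; rewrite in_itv/= andbT.
    rewrite (_ : [set _ | _] = `]-oo, - b + jm.2%:R * h[%classic) //.
    apply/seteqP; split => a /=; rewrite in_itv/= ltNge; first by move=> ->.
    by move/negbTE.
  apply/seteqP; split => l /=; first by move=> <- jm _; rewrite ffunE.
  by move=> lv; apply/ffunP => jm; rewrite ffunE lv.
- move=> v x; rewrite /rep; case: xgetP => [l _ [lb _]|_]; first exact: lb.
  by rewrite /pairing lfunE/= normr0.
- move=> l lb x.
  have [rb rl] : [set l' | ballD l' /\ cell l' = cell l] (rep (cell l)).
    exact: (xgetI _ (x := l)).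
  have close j : `|pairing (rep (cell l)) (e_ j) - pairing l (e_ j)| <= h.
    have bb (l' : dual E) : ballD l' -> - b <= pairing l' (e_ j) <= b.
      move=> l'b; rewrite -ler_norml (le_trans (l'b _))// /b (bigD1 j)//= lerDl sumr_ge0//.
    have cE (m : 'I_N) : (- b + m%:R * h <= pairing (rep (cell l)) (e_ j)) =
        (- b + m%:R * h <= pairing l (e_ j)).
      by have := congr1 (fun c : {ffun _ -> _} => c (j, m)) rl; rewrite !ffunE.
    rewrite ler_distlC lerBlDr; apply/andP; split.
      by apply: (@grid_close b) => //; exact: bb.
    by apply: (@grid_close b) => //; exact: bb.
  rewrite -pairingBl pairing_r2v (le_trans (ler_norm_sum _ _ _))//.
  apply: (@le_trans _ _ (\sum_(j < dim E) (C * `|x|) * h)).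
    apply: ler_sum => j _; rewrite normrM ler_pM//.
    by rewrite pairingBl close.
  rewrite sumr_const card_ord -[_ *+ dim E]mulr_natr.
  have -> : C * `|x| * h * (dim E)%:R = theta / (dim E).+1%:R * (dim E)%:R * `|x|.
    have : (dim E).+1%:R != 0 :> R by rewrite pnatr_eq0.
    by rewrite /h; move: (dim E).+1%:R => D D0; field; rewrite D0 gt_eqF.
  rewrite ler_wpM2r// mulrAC ler_pdivrMr// ler_wpM2l ?(ltW theta0)//.
  by rewrite ler_nat.
Qed.

End DualMeasurability.

(** * The minimal dual norm of a convex combination *)

Section DualNorm.
Variables (R : realType) (E : normedVectType R).
Import VectorInternalTheory.

Lemma pairing_le_dual_norm (l : dual E) x : `|x| <= 1 ->
  ((pairing l x)%:E <= dual_norm l)%E.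
Proof. by move=> x1; apply: ereal_sup_ubound; exists x => //; apply/cball0E. Qed.

Lemma dual_norm_le1 (l : dual E) : (dual_norm l <= 1%:E)%E ->
  forall x, `|pairing l x| <= `|x|.
Proof.
move=> l1; have lx x : pairing l x <= `|x|.
  have [->|x0] := eqVneq x 0; first by rewrite /pairing linear0 normr0.
  rewrite -[leRHS]mulr1 -ler_pdivrMl ?normr_gt0// -pairingZr -lee_fin.
  apply: le_trans l1; apply: pairing_le_dual_norm.
  by rewrite normrZ ger0_norm ?invr_ge0// mulVf ?normr_eq0.
by move=> x; rewrite ler_norml lerNl -pairingNr -{1}(normrN x) !lx.
Qed.

(** Minimax duality between weights and points of the unit ball, with [x] replaced by [- x] to turn
    norms into negative margins. The strict inequality leaves room for the error of the approximate
    minimax. *)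
Lemma ereal_inf_dual_norm_le M (z : 'I_M -> dual E) (c : R) : (0 < M)%N ->
  ((ereal_inf [set dual_norm (\sum_(i < M) lam i *: z i)%R | lam in simplex M] <= c%:E)%E
   <-> ~ exists2 x, `|x| <= 1 & forall i, pairing (z i) x < - c).
Proof.
move=> M0; split.
  move=> + [x x1 zx]; apply/negP; rewrite -ltNge.
  (* The default lies below [- c], so that the finite maximum of the pairings stays strictly below
     it. *)
  pose s := \big[Num.max/(- c - 1)]_i pairing (z i) x.
  have sc : s < - c by rewrite bigmax_lt//; lra.
  apply: (@lt_le_trans _ _ (- s)%:E); first by rewrite lte_fin ltrNr.
  apply: le_ereal_inf_tmp => _ [lam [lam0 lam1] <-].
  apply: le_trans (pairing_le_dual_norm _ (x := - x) _); last by rewrite normrN.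
  rewrite lee_fin pairingNr lerN2 pairing_suml -[leRHS]mul1r -lam1 mulr_suml.
  apply: ler_sum => i _; rewrite ler_wpM2l// /s.
  by rewrite (bigD1 i)//= le_max lexx.
move=> xz; rewrite leNgt; apply/negP => cinf; apply: xz.
(* A level strictly between [c] and the infimum, which may be infinite; half of the gap [c' - c] is
   later spent in the minimax. *)
have [c' cc' c'inf] : exists2 c', c < c' & forall lam, simplex M lam ->
    exists2 x, `|x| <= 1 & \sum_i lam i * pairing (z i) x <= - c'.
  have [c' cc' c'inf] : exists2 c', c < c' & (c'%:E < ereal_inf
      [set dual_norm (\sum_(i < M) lam i *: z i)%R | lam in simplex M])%E.
    move: cinf; case: ereal_inf => [v| |] //.
      by rewrite lte_fin => cv; exists ((c + v) / 2); rewrite ?lte_fin; lra.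
    by move=> _; exists (c + 1); rewrite ?ltry//; lra.
  exists c' => // lam lamS.
  have : (c'%:E < dual_norm (\sum_(i < M) lam i *: z i)%R)%E.
    by apply: lt_le_trans c'inf _; apply: ereal_inf_lbound; exists lam.
  move=> /ereal_sup_gt[_ [x /cball0E x1 <-]]; rewrite lte_fin pairing_suml => xc'.
  exists (- x); rewrite ?normrN//.
  under eq_bigr do rewrite pairingNr mulrN.
  by rewrite sumrN lerN2 ltW.
have [b bz] : exists b, forall i x, `|x| <= 1 -> `|pairing (z i) x| <= b.
  have /choice[b bz] : forall i, exists b : R, 0 <= b /\ forall x, `|pairing (z i) x| <= b * `|x|.
    by move=> i; have [b b0 bz] := pairing_bounded (z i); exists b.
  exists (\sum_i b i) => i x x1.
  rewrite (le_trans ((bz i).2 x))// (le_trans (y := b i))//.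
    by rewrite ler_piMr// (bz i).1.
  rewrite (bigD1 i)//= lerDl sumr_ge0// => j _; exact: (bz j).1.
have [|x x1 zx] := approx_minimax M0 bz c'inf (e := (c' - c) / 2); first by lra.
by exists x => // i; rewrite (le_lt_trans (zx i))//; lra.
Qed.

Lemma rat_approx_r2v (x : E) (a : R) : 0 < a ->
  exists q : {ffun 'I_(dim E) -> rat}, `|r2v (\row_j ratr (q j)) - x| <= a.
Proof.
move=> a0; pose L := \sum_j `|r2v (delta_mx 0 j) : E|.
have L1 : 0 < L + 1 by rewrite ltr_wpDl// sumr_ge0.
have aL : 0 < a / (L + 1) by rewrite divr_gt0.
have /choice[q qx] : forall j, exists q, `|ratr q - v2r x 0 j| <= a / (L + 1).
  move=> j; have [|q] := @rat_in_itvoo R (v2r x 0 j) (v2r x 0 j + a / (L + 1)).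
    by rewrite ltrDl.
  by rewrite in_itv/= => /andP[q1 q2]; exists q; rewrite ler_norml; apply/andP; split; lra.
exists (finfun q); rewrite -[X in _ - X]v2rK -linearB.
apply: (le_trans (norm_r2v (a := a / (L + 1)) _)).
  by move=> j; rewrite !mxE ffunE.
by rewrite mulrAC ler_pdivrMr// ler_wpM2l ?(ltW a0)// lerDl.
Qed.

(** Reduces the search in the unit ball to countably many points, for measurability. A rational
    approximation may leave the ball, so the margin is made homogeneous by the factor
    [Num.max 1 |x|], and dividing by this factor returns to the ball. *)
Lemma rat_strict_margin M (z : 'I_M -> dual E) (c : R) : 0 <= c ->
  (exists2 x, `|x| <= 1 & forall i, pairing (z i) x < - c) <->
  exists q : {ffun 'I_(dim E) -> rat}, forall i,
    pairing (z i) (r2v (\row_j ratr (q j))) < - (c * Num.max 1 `|r2v (\row_j ratr (q j)) : E|).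
Proof.
move=> c0; split; last first.
  move=> [q]; set x : E := r2v _ => zx; set m := Num.max 1 `|x| in zx *.
  have m0 : 0 < m by rewrite lt_max ltr01.
  exists (m^-1 *: x).
    by rewrite normrZ gtr0_norm ?invr_gt0// mulrC ler_pdivrMr// mul1r le_max lexx orbT.
  by move=> i; rewrite pairingZr mulrC ltr_pdivrMr// mulNr.
move=> [x x1 zx].
have /choice[b bz] : forall i, exists b : R, 0 <= b /\ forall x, `|pairing (z i) x| <= b * `|x|.
  by move=> i; have [b b0 bz] := pairing_bounded (z i); exists b.
pose B := \sum_i b i.
have B0 : 0 <= B by rewrite sumr_ge0// => i _; exact: (bz i).1.
have bB i : b i <= B.
  by rewrite /B (bigD1 i)//= lerDl sumr_ge0// => j _; exact: (bz j).1.
pose s := \big[Num.max/(- c - 1)]_i pairing (z i) x.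
have sc : s < - c by rewrite bigmax_lt//; lra.
have zs i : pairing (z i) x <= s by rewrite /s (bigD1 i)//= le_max lexx.
(* Moving [x] by at most [a] raises a pairing by at most [B * a] and lowers the threshold by at most
   [c * a]. The added 1 keeps their sum strictly below the slack [- c - s]. *)
have Bc : 0 < B + c + 1 by lra.
have a0 : 0 < (- c - s) / (B + c + 1) by rewrite divr_gt0//; lra.
have [q] := rat_approx_r2v x a0; set y : E := r2v _; set a := _ / _ => yx.
have aE : a * (B + c + 1) = - c - s by rewrite divfK// gt_eqF.
exists q => i; rewrite -/y.
have y1 : Num.max 1 `|y| <= 1 + a.
  rewrite ge_max lerDl (ltW a0)/= -[y](subrK x) (le_trans (ler_normD _ _))//; lra.
have cy : c * Num.max 1 `|y| <= c * (1 + a) by rewrite ler_wpM2l.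
have /(le_trans (ler_norm _)) zyx := (bz i).2 (y - x).
have bya : b i * `|y - x| <= B * a by rewrite ler_pM// (bz i).1.
move: zyx; rewrite pairingBr => zyx; have := zs i; move: a0; rewrite -/a; nra.
Qed.

(** The infimum runs over an uncountable simplex; by duality and rational approximation, the
    complement of the event is a countable union of finite intersections of half-space events. *)
Lemma measurable_ereal_inf_dual_norm d (Omega : measurableType d) M
    (z : 'I_M -> Omega -> dual E) (c : R) : (0 < M)%N -> 0 <= c ->
  (forall i, measurable_fun setT (z i)) ->
  measurable [set w | (ereal_inf [set dual_norm (\sum_(i < M) lam i *: z i w)%R | lam in simplex M]
    <= c%:E)%E].
Proof.
move=> M0 c0 mz.
rewrite (_ : [set w | _] = ~` \bigcup_(q in [set: {ffun 'I_(dim E) -> rat}])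
  \bigcap_(i in [set: 'I_M]) [set w | pairing (z i w) (r2v (\row_j ratr (q j))) <
    - (c * Num.max 1 `|r2v (\row_j ratr (q j)) : E|)]); last first.
  apply/seteqP; split => w /=.
    move=> /ereal_inf_dual_norm_le -/(_ M0) H [q _ qz]; apply: H.
    by apply/rat_strict_margin => //; exists q => i; exact: qz.
  move=> H; apply/ereal_inf_dual_norm_le => // /rat_strict_margin -/(_ c0) [q qz].
  by apply: H; exists q => // i _; exact: qz.
apply: measurableC; apply: countable_bigcupT_measurable => // q.
apply: fin_bigcap_measurable => // i _.
set x : E := r2v _; set C : R := - _.
rewrite -[X in measurable X]setTI.
apply: (mz i measurableT [set l | `]-oo, C[%classic (pairing l x)]).
exact: measurable_pairing.
Qed.

End DualNorm.

(** * Convex functions and singletons *)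

Section ConvexFunctions.
Variables (R : realType).

Lemma convex_functionP (E : normedVectType R) (f : E -> R) :
  convex_function [set: convex_lmodType E] (f : convex_lmodType E -> R^o) <->
  forall x y (t : R), 0 <= t <= 1 -> f (t *: x + (1 - t) *: y) <= t * f x + (1 - t) * f y.
Proof.
split=> [cf x y t /andP[t0 t1]|cf t x y _ _].
  by have := cf (Itv01 t0 t1) x y (in_setT _) (in_setT _).
by apply: cf; rewrite ge0 le1.
Qed.

(** For rationals [A < x < Y < C], convexity bounds [f x] by the chord of [f] from [A] to [Y], and
    [g Y] by the chord of [g] from [x] to [C]. As [f Y = g Y], letting [Y] decrease to [x] compares
    [f x] with [g x]. *)
Lemma convex_eq_on_rat (f g : R -> R) :
  (forall x y (t : R), 0 <= t <= 1 -> f (t * x + (1 - t) * y) <= t * f x + (1 - t) * f y) ->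
  (forall x y (t : R), 0 <= t <= 1 -> g (t * x + (1 - t) * y) <= t * g x + (1 - t) * g y) ->
  (forall q : rat, f (ratr q) = g (ratr q)) -> forall x, f x <= g x.
Proof.
have chord (h : R -> R) : (forall x y (t : R), 0 <= t <= 1 ->
      h (t * x + (1 - t) * y) <= t * h x + (1 - t) * h y) ->
    forall a x c, a < x -> x < c -> h x * (c - a) <= (c - x) * h a + (x - a) * h c.
  move=> ch a x c ax xc; have ca : 0 < c - a by lra.
  have [t tE t01] : exists2 t, t * (c - a) = c - x & 0 <= t <= 1.
    exists ((c - x) / (c - a)); first by rewrite divfK// gt_eqF.
    by apply/andP; split; [apply: divr_ge0|rewrite ler_pdivrMr// mul1r]; lra.
  have xE : t * a + (1 - t) * c = x by lra.
  have := ch a c t t01; rewrite xE -(ler_pM2r ca) => /le_trans; apply.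
  have -> : (t * h a + (1 - t) * h c) * (c - a) =
      t * (c - a) * h a + (c - a - t * (c - a)) * h c by ring.
  by rewrite tE (_ : c - a - (c - x) = x - a)//; ring.
move=> cf cg fg x; rewrite leNgt; apply/negP => gfx.
have [|a] := @rat_in_itvoo R (x - 1) x; first lra.
rewrite in_itv/= => /andP[_ ax].
have [|c] := @rat_in_itvoo R x (x + 1); first lra.
rewrite in_itv/= => /andP[xc _].
pose A : R := ratr a; pose C : R := ratr c.
(* Combining the two chord inequalities gives [d <= (Y - x) * K], which fails once
   [(Y - x) * (|K| + 1) < d]. *)
pose K := (C - x) * (f A - f x) + (x - A) * (g C - g x).
pose d := (f x - g x) * (x - A) * (C - x).
have d0 : 0 < d by rewrite !mulr_gt0// subr_gt0.
have s0 : 0 < Num.min (C - x) (d / (`|K| + 1)).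
  by rewrite lt_min subr_gt0 xc/= divr_gt0// ltr_wpDl.
have [|y] := @rat_in_itvoo R x (x + Num.min (C - x) (d / (`|K| + 1))); first by rewrite ltrDl.
rewrite in_itv/= -ltrBlDl lt_min => /andP[xy /andP[yC ys]].
have K1 : 0 < `|K| + 1 by rewrite ltr_wpDl.
rewrite ltr_pdivlMr// in ys.
set Y : R := ratr y in xy yC ys *.
have xAY := chord f cf A x Y ax xy.
have yYC : Y < C by lra.
have xYC := chord g cg x Y C xy yYC.
have fY : f Y = g Y := fg y.
rewrite fY in xAY.
have CX : 0 < C - x by rewrite subr_gt0.
have XA : 0 < x - A by rewrite subr_gt0.
have {}xAY := ler_wpM2r (ltW CX) xAY.
have {}xYC := ler_wpM2l (ltW XA) xYC.
have dK : d <= (Y - x) * K.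
  by rewrite /d /K; move: xAY xYC; clear; clearbody A C Y; lra.
have KK : (Y - x) * K <= (Y - x) * `|K| by rewrite ler_wpM2l ?ler_norm//; lra.
lra.
Qed.

Variable E : normedVectType R.
Import VectorInternalTheory.

Lemma convex_eq_on_rat_r2v (f g : E -> R) :
  convex_function [set: convex_lmodType E] (f : convex_lmodType E -> R^o) ->
  convex_function [set: convex_lmodType E] (g : convex_lmodType E -> R^o) ->
  (forall q : {ffun 'I_(dim E) -> rat},
    f (r2v (\row_j ratr (q j))) = g (r2v (\row_j ratr (q j)))) -> f = g.
Proof.
move=> /convex_functionP cf /convex_functionP cg fg; apply/funext => x.
(* The coordinates are freed from being rational one after the other. *)
suff H k : (k <= dim E)%N -> forall u : 'rV[R]_(dim E),
    (forall j : 'I_(dim E), (k <= j)%N -> exists q : rat, u 0 j = ratr q) ->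
    f (r2v u) = g (r2v u).
  rewrite -[x]v2rK; apply: (H (dim E)) => // j.
  by rewrite leqNgt ltn_ord.
elim: k => [_ u uq|k IH kn u uq].
  have /choice[q qE] : forall j, exists q : rat, u 0 j = ratr q by move=> j; exact: uq.
  have -> : u = \row_j ratr ((finfun q : {ffun _ -> rat}) j).
    by apply/rowP => j; rewrite mxE ffunE qE.
  exact: fg.
pose i := Ordinal kn.
pose line (s : R) : 'rV[R]_(dim E) := \row_j (if j == i then s else u 0 j).
have lineu : line (u 0 i) = u.
  by apply/rowP => j; rewrite mxE; case: eqP => [->|].
have lineD x1 y (t : R) : line (t * x1 + (1 - t) * y) = t *: line x1 + (1 - t) *: line y.
  by apply/rowP => j; rewrite !mxE; case: eqP => // _; ring.
have cline (h : E -> R) : (forall x y (t : R), 0 <= t <= 1 ->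
    h (t *: x + (1 - t) *: y) <= t * h x + (1 - t) * h y) ->
  forall x y (t : R), 0 <= t <= 1 -> h (r2v (line (t * x + (1 - t) * y))) <=
    t * h (r2v (line x)) + (1 - t) * h (r2v (line y)).
  by move=> ch x1 y t t01; rewrite lineD linearD !linearZ; exact: ch.
have rline q : f (r2v (line (ratr q))) = g (r2v (line (ratr q))).
  apply: IH => [|j kj]; first exact: ltnW.
  rewrite mxE; case: eqP => [_|/eqP ji]; first by exists q.
  by apply: uq; rewrite ltn_neqAle kj andbT eq_sym.
rewrite -lineu; apply/eqP; rewrite eq_le; apply/andP; split.
  exact: (convex_eq_on_rat (cline _ cf) (cline _ cg)).
by apply: (convex_eq_on_rat (cline _ cg) (cline _ cf)) => q; rewrite rline.
Qed.

(** A convex function is determined by its values at the points with rational coordinates, so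
    countably many evaluations isolate [f] inside [F], itself a generator of the sigma-algebra. *)
Lemma measurable_convex_singleton (F : set (E -> R)) (f : E -> R) :
  (forall g, F g -> convex_function [set: convex_lmodType E] (g : convex_lmodType E -> R^o)) ->
  F f -> measurable ([set f] : set (g_sigma_algebraType (class_sets F))).
Proof.
move=> Fc Ff.
pose x (q : {ffun 'I_(dim E) -> rat}) : E := r2v (\row_j ratr (q j)).
rewrite (_ : [set f] = F `&` ~` \bigcup_(q in [set: {ffun 'I_(dim E) -> rat}])
    [set g | (~` [set f (x q)]) (g (x q))]); last first.
  apply/seteqP; split => [g -> /=|g [/= Fg gf]].
    by split => // -[q _]; apply.
  apply: convex_eq_on_rat_r2v => [||q]; [exact: Fc|exact: Fc|].
  by apply: contrapT => gfq; apply: gf; exists q.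
apply: measurableI; first by apply: sub_sigma_algebra; right.
apply: measurableC; apply: countable_bigcupT_measurable => // q.
apply: sub_sigma_algebra; left; exists (x q), (~` [set f (x q)]) => //.
exact: measurableC.
Qed.

End ConvexFunctions.

(** * Smooth classes and the hard functions *)

Section SmoothClass.
Variables (R : realType) (E : normedVectType R).

Lemma iter_diffZ (k : nat) (f : E -> R) (c : R) : times_differentiable k f ->
  forall hs : seq E, (size hs <= k)%N ->
  iter_diff (fun x => c * f x) hs = (fun x => c * iter_diff f hs x).
Proof.
move=> df; elim => [|h hs IH] //= hsk; apply/funext => x.
rewrite IH ?(ltnW hsk)//.
have dfx := df hs hsk x.
have -> : (fun x0 : E => c * iter_diff f hs x0) = c *: (iter_diff f hs : E -> R^o) by [].
by rewrite diffZ.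
Qed.

Lemma times_differentiableZ (k : nat) (f : E -> R) (c : R) : times_differentiable k f ->
  times_differentiable k (fun x => c * f x).
Proof.
move=> df hs hsk x; rewrite (iter_diffZ _ df) ?(ltnW hsk)//.
exact: (differentiableZ (f := iter_diff f hs : E -> R^o) c (df hs hsk x)).
Qed.

Lemma smooth_class_scale (kappa mu : R) (f : E -> R) : 0 < mu ->
  smooth_class kappa mu f -> smooth_class kappa 1 (fun x => mu^-1 * f x).
Proof.
move=> mu0 [/convex_functionP cf sf].
have muV0 : 0 <= mu^-1 by rewrite invr_ge0 ltW.
split.
  apply/convex_functionP => x y t t01.
  by rewrite !(mulrCA _ mu^-1) -mulrDr ler_wpM2l// cf.
have [k0|k0] := eqVneq kappa 0; rewrite ?k0 ?eqxx ?(negbTE k0) in sf *.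
  move=> x y gx gy sx sy.
  have sub u (gu : dual E) : subgradient (fun x => mu^-1 * f x) u gu -> subgradient f u (mu *: gu).
    move=> su v; have := su v; rewrite /= -(ler_pM2l mu0) mulrDr !mulVKf ?gt_eqF//.
    by rewrite /pairing scale_lfunE.
  have := sf x y _ _ (sub _ _ sx) (sub _ _ sy).
  move=> s1; apply: ge_ereal_sup => _ [v v1 <-].
  rewrite lee_fin -(ler_pM2l mu0) mulr1 -lee_fin.
  apply: le_trans s1; apply: ereal_sup_ubound; exists v => //.
  by rewrite /pairing !lfun_simp /= -mulrBr.
move: sf => /= [df bf]; split; first exact: times_differentiableZ.
move=> x y; apply: ge_ereal_sup => _ [h h1 <-].
rewrite !(iter_diffZ _ df) ?size_nseq// lee_fin mul1r -mulrBr normrM ger0_norm//.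
rewrite ler_pdivrMl// -lee_fin; apply: le_trans (bf x y).
by apply: ereal_sup_ubound; exists h.
Qed.

(** Only the first [m] vectors enter, and the growing offsets favour small indices. The class of
    order 0 bounds differences of subgradients by 1; the factor one half makes each subgradient at
    most one half in dual norm. The norm term is the default of the maximum, so [m = 0] is
    meaningful. *)
Definition hard M (zeta : 'I_M -> dual E) (delta : R) (m : nat) (x : E) : R :=
  2^-1 * \big[Num.max/`|x| - 2]_(i < M | (i < m)%N) (pairing (zeta i) x - i.+1%:R * delta).

Section Hard.
Variables (M : nat) (zeta : 'I_M -> dual E) (delta : R).
Hypothesis zeta1 : forall i x, `|pairing (zeta i) x| <= `|x|.
Let phi m (x : E) :=
  \big[Num.max/`|x| - 2]_(i < M | (i < m)%N) (pairing (zeta i) x - i.+1%:R * delta).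

Let phi_norm m x : `|x| - 2 <= phi m x.
Proof. exact: bigmax_ge_id. Qed.

Let phi_pairing m x (i : 'I_M) : (i < m)%N ->
  pairing (zeta i) x - i.+1%:R * delta <= phi m x.
Proof.
by move=> im; rewrite /phi (bigD1 i)//= le_max lexx.
Qed.

Let hard_lipschitz m x y : hard zeta delta m y <= hard zeta delta m x + 2^-1 * `|y - x|.
Proof.
rewrite /hard -/(phi m x) -/(phi m y) -mulrDr ler_wpM2l//.
apply/bigmax_leP; split=> [|i im].
  have := phi_norm m x; have := ler_normD (y - x) x; rewrite subrK; lra.
have := phi_pairing x im; have := ler_norm (pairing (zeta i) (y - x)).
have := zeta1 i (y - x); rewrite pairingBr; lra.
Qed.

Lemma hard_smooth m : smooth_class 0 1 (hard zeta delta m).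
Proof.
split.
  apply/convex_functionP => x y t /andP[t0 t1]; have t1' : 0 <= 1 - t by lra.
  rewrite /hard -/(phi m x) -/(phi m y) !(mulrCA _ 2^-1) -mulrDr ler_wpM2l//.
  apply/bigmax_leP; split=> [|i im].
    have := ler_wpM2l t0 (phi_norm m x); have := ler_wpM2l t1' (phi_norm m y).
    have := ler_normD (t *: x) ((1 - t) *: y); rewrite !normrZ !ger0_norm//; lra.
  have := ler_wpM2l t0 (phi_pairing x im); have := ler_wpM2l t1' (phi_pairing y im).
  by rewrite pairingDr !pairingZr; lra.
rewrite eqxx => x y gx gy sx sy.
have sub u (gu : dual E) v : subgradient (hard zeta delta m) u gu -> pairing gu v <= 2^-1 * `|v|.
  move=> su; have := su (u + v); have := hard_lipschitz m u (u + v).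
  rewrite addrAC subrr add0r; lra.
apply: ge_ereal_sup => _ [v /cball0E v1 <-]; rewrite lee_fin pairingBl -pairingNr.
by have := sub _ _ v sx; have := sub _ _ (- v) sy; rewrite normrN; lra.
Qed.

End Hard.
End SmoothClass.

(** * Runs against a resisting oracle *)

Section ResistingOracle.
Variables (R : realType) (E : normedVectType R) (X : set E) (K M : nat).
Variables (Ans : Type) (O : (E -> R) -> E -> Ans) (kappa eta r mu eps delta : R).
Hypothesis O_local : local_oracle (smooth_class kappa 1) X O.
Variable S : (E -> R) -> E -> R.
Hypothesis S_smooth : forall f, smooth_class 0 1 f -> smooth_class kappa mu (S f).
Hypothesis S_close : forall f, smooth_class 0 1 f -> forall x, `|f x - S f x| <= eta.
Hypothesis S_local : forall f g x, smooth_class 0 1 f -> smooth_class 0 1 g ->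
  {in cball x (2 * r), f =1 g} -> {in cball x r, S f =1 S g}.
Hypotheses (mu_gt0 : 0 < mu) (r_gt0 : 0 < r) (r_le : r <= delta / 8).
Variable zeta : 'I_M -> dual E.
Hypothesis zeta1 : forall i x, `|pairing (zeta i) x| <= `|x|.
Variable A : @transcript R E K Ans -> @batch R E K.
Hypothesis AX : algorithms X A.

Definition smoothed_hard m (x : E) : R := mu^-1 * S (hard zeta delta m) x.

(** The batch of round [t + 1] is computed on the function with [t] vectors, hence depends on these
    vectors only. This is what lets independence apply; [run_smoothed_hard] relates it to the actual
    run. *)
Definition query t : @batch R E K := A (run O A (smoothed_hard t) t).

Hypothesis delta_le : delta <= 2^-1.
Hypothesis query_lower : forall (t : 'I_M) k,
  - (delta / 10 * Num.max 1 `|query t k|) <= pairing (zeta t) (query t k).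
Hypothesis query_upper : forall (t i : 'I_M) k, (t < i)%N ->
  pairing (zeta i) (query t k) <= delta / 10 * Num.max 1 `|query t k|.

Let smoothed_hard_smooth m : smooth_class kappa 1 (smoothed_hard m).
Proof. exact/smooth_class_scale/S_smooth/hard_smooth. Qed.

Let delta_gt0 : 0 < delta.
Proof. by move: r_gt0 r_le; lra. Qed.

Let max_query (t : 'I_M) k :
  `|query t k| <= 5 / 2 -> Num.max 1 `|query t k| <= 5 / 2.
Proof. by move=> x; rewrite ge_max x andbT; lra. Qed.

(** Let [i > t]. If [|x| <= 5 / 2], then within [2 * r <= delta / 4] of [x] the pairing with
    [zeta i] is at most [delta / 2] and that with [zeta t] at least [- delta / 2], so the offset gap
    [delta] lets term [t] dominate. Farther out, [|y| - 2] dominates since pairings at [x] are at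
    most [|x| / 20]. *)
Lemma hard_local (t : 'I_M) k m : (t < m)%N ->
  {in cball (query t k) (2 * r), hard zeta delta m =1 hard zeta delta t.+1}.
Proof.
move=> tm y; rewrite inE /cball /closed_ball_ /=; set x := query t k => xy.
rewrite /hard; congr (_ * _); apply/eqP; rewrite eq_le; apply/andP; split; last first.
  apply/bigmax_leP; split=> [|i it]; first exact: bigmax_ge_id.
  exact: (le_bigmax_cond _ _ (leq_trans it tm)).
apply/bigmax_leP; split=> [|i im]; first exact: bigmax_ge_id.
have [it|ti] := leqP i t.
  exact: (@le_bigmax_cond _ _ _ (`|y| - 2) i (fun i : 'I_M => (i < t.+1)%N)
            (fun i => pairing (zeta i) y - i.+1%:R * delta)).
have yx : `|y - x| <= 2 * r by rewrite distrC.
have := zeta1 i (y - x); rewrite ler_norml pairingBr => /andP[_ ziy].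
have zix := query_upper k ti; rewrite -/x in zix.
have ti' : t.+2%:R <= i.+1%:R :> R by rewrite ler_nat.
have ti2 : t.+2%:R * delta <= i.+1%:R * delta by rewrite ler_wpM2r ?(ltW delta_gt0).
have [x52|x52] := leP `|x| (5 / 2).
  apply: (@le_trans _ _ (pairing (zeta t) y - t.+1%:R * delta)); last first.
    exact: (@le_bigmax_cond _ _ _ (`|y| - 2) t (fun i : 'I_M => (i < t.+1)%N)
            (fun i => pairing (zeta i) y - i.+1%:R * delta)).
  have := zeta1 t (y - x); rewrite ler_norml pairingBr => /andP[zty _].
  have ztx := query_lower t k; rewrite -/x in ztx.
  have dm : delta / 10 * Num.max 1 `|x| <= delta / 10 * (5 / 2).
    by rewrite ler_wpM2l ?max_query//; move: delta_gt0; lra.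
  move: ti2; rewrite -natr1 mulrDl mul1r; move: r_le; lra.
apply: (@le_trans _ _ (`|y| - 2)); last exact: bigmax_ge_id.
have mx : Num.max 1 `|x| = `|x| by apply/max_idPr; lra.
rewrite mx in zix.
have := ler_normD (x - y) y; rewrite subrK.
have dx : delta / 10 * `|x| <= 20^-1 * `|x| by rewrite ler_wpM2r//; move: delta_le; lra.
have i0 : 0 <= i.+1%:R * delta by rewrite mulr_ge0 ?(ltW delta_gt0).
move: r_le delta_le delta_gt0; lra.
Qed.

(** Induction on the rounds. The unsmoothed functions agree on balls of radius [2 * r] around the
    queries of the next round, so the smoothed ones agree on balls of radius [r] and the local
    oracle answers alike. *)
Lemma run_smoothed_hard s m : (s <= m)%N -> (m <= M)%N ->
  run O A (smoothed_hard m) s = run O A (smoothed_hard s) s.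
Proof.
elim: s m => [//|s IH] m sm mM /=.
rewrite IH// ?(ltnW sm)// (IH s.+1)//; last exact: leq_trans mM.
rewrite -/(query s); congr (rcons _ (_, _)); apply/funext => k.
have sM : (s < M)%N by exact: leq_trans mM.
apply: O_local => //; first exact: AX.
apply/nbhs_ballP; exists r => //= y; rewrite -ball_normE /= => /ltW xy.
congr (_ * _).
apply: (S_local (x := query s k)); [exact: hard_smooth|exact: hard_smooth| |by rewrite inE].
exact: (@hard_local (Ordinal sM)).
Qed.

Hypotheses (eps_gt0 : 0 < eps) (eta_le : eta <= eps * mu / 4) (delta_le_eps : delta * M%:R <= mu * eps).
Hypothesis X_ball : cball 0 1 `<=` X.
Variable x0 : E.
Hypotheses (x0_ball : `|x0| <= 1)
  (x0_margin : forall i, pairing (zeta i) x0 <= - (4 * mu * eps) + delta / 110).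

(** Before round [M], unsmoothed values at a query and at [x0] differ by more than
    [3 / 2 * mu * eps]. Smoothing costs at most [2 * eta <= mu * eps / 2], so dividing by [mu]
    leaves a gap above [eps]. *)
Lemma rounds_smoothed_hard : (M%:R%:E <= rounds X O A (smoothed_hard M) eps)%E.
Proof.
apply: le_ereal_inf_tmp => _ [t [k]] + <-; rewrite lee_fin ler_nat.
apply: contraPT; rewrite -ltnNge => tM [_].
have tM' : (t < M)%N by exact: ltnW.
rewrite (run_smoothed_hard (ltnW tM') (leqnn M)) -/(query t); set x := query t k.
pose T := Ordinal tM'.
apply/negP; rewrite -ltNge.
apply: (@lt_le_trans _ _ ((smoothed_hard M x)%:E - (smoothed_hard M x0)%:E)%E); last first.
  apply: leeB => //; apply: ereal_inf_lbound; exists x0 => //.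
  by apply: X_ball; apply/cball0E.
rewrite -EFinB lte_fin /smoothed_hard -mulrBr ltr_pdivlMl//.
have hM := hard_smooth delta zeta1 M.
have := S_close hM x; have := S_close hM x0; rewrite !ler_norml => /andP[h01 h02] /andP[h1 h2].
have hx0 : hard zeta delta M x0 <= 2^-1 * (- (4 * mu * eps) + delta / 110).
  rewrite ler_wpM2l//; apply/bigmax_leP; split=> [|i _].
    (* The norm term obeys the same bound because [|x0| - 2 <= -1 <= pairing (zeta T) x0]. *)
    have := x0_margin T; have := zeta1 T x0; rewrite ler_norml => /andP[]; move: x0_ball; lra.
  rewrite lerBlDr (le_trans (x0_margin i))// lerDl mulr_ge0// ltW//.
have me : 0 < mu * eps by rewrite mulr_gt0.
have hx : 2^-1 * (- (mu * eps) + delta * (3 / 4)) <= hard zeta delta M x.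
  rewrite ler_wpM2l//; have [x52|x52] := leP `|x| (5 / 2).
    apply: (@le_trans _ _ (pairing (zeta T) x - T.+1%:R * delta)); last first.
      exact: (@le_bigmax_cond _ _ _ (`|x| - 2) T (fun i : 'I_M => (i < M)%N)
            (fun i => pairing (zeta i) x - i.+1%:R * delta)).
    have ztx : - (delta / 10 * Num.max 1 `|x|) <= pairing (zeta T) x := query_lower T k.
    have dm : delta / 10 * Num.max 1 `|x| <= delta / 10 * (5 / 2).
      by rewrite ler_wpM2l ?(@max_query T)//; move: delta_gt0; lra.
    (* Round [t + 1] precedes round [M], so the offset [t.+1 * delta] is at least one [delta] short
       of [M * delta]. A quarter of it pays for the pairing, and [3 / 4 * delta] remains. *)
    have tMR : t.+2%:R <= M%:R :> R by rewrite ler_nat.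
    have : delta * t.+2%:R <= delta * M%:R by rewrite ler_wpM2l ?(ltW delta_gt0).
    rewrite -natr1 mulrDr mulr1 /= [t.+1%:R * _]mulrC; move: delta_le_eps; lra.
  apply: (@le_trans _ _ (`|x| - 2)); last exact: bigmax_ge_id.
  by move: delta_le; lra.
move: eta_le delta_gt0; lra.
Qed.

End ResistingOracle.

(** * Union bounds over adaptive queries *)

Section Adaptivity.
Variables (R : realType) (d d' : measure_display) (Omega : measurableType d)
  (T : measurableType d') (P : probability Omega R) (M : nat) (z : 'I_M -> {RV P >-> T}).
Variables (V : finType) (cell : T -> V).
Hypothesis mcell : forall v, measurable [set l | cell l = v].

Definition cells (w : Omega) : {ffun 'I_M -> V} := [ffun i => cell (z i w)].

Lemma measurable_cells (A : set {ffun 'I_M -> V}) : measurable [set w | A (cells w)].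
Proof.
rewrite (_ : [set w | _] = \bigcup_(u in A) \bigcap_(i in [set: 'I_M])
    [set w | [set l | cell l = u i] (z i w)]).
  apply: fin_bigcup_measurable => [|u _]; first exact: finite_finset.
  by apply: fin_bigcap_measurable => // i _; exact: (measurable_funPTI (z i) (mcell _)).
apply/seteqP; split=> [w Aw|w [u Au uw]] /=.
  by exists (cells w) => // i _ /=; rewrite ffunE.
by suff -> : cells w = u by []; apply/ffunP => i; rewrite ffunE; exact: uw.
Qed.

Hypothesis z_indep : mutually_independent z.

(* A choice [H] depending on the cells of the first [t] vectors only can be
   handled as if it were constant, by conditioning on these cells. *)
Lemma adaptive_choice_bound (t : nat) (i : 'I_M) (H : {ffun 'I_M -> V} -> set T) (p : R) :
  (t <= i)%N -> 0 <= p ->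
  (forall u, measurable (H u)) ->
  (forall u u' : {ffun 'I_M -> V},
     (forall j : 'I_M, (j < t)%N -> u j = u' j) -> H u = H u') ->
  (forall u, (P [set w | H u (z i w)] <= p%:E)%E) ->
  measurable [set w | H (cells w) (z i w)] /\
  (P [set w | H (cells w) (z i w)] <= p%:E)%E.
Proof.
move=> ti p0 mH locH Hp.
have [w0 _] : [set: Omega] !=set0.
  apply/set0P/eqP => O0; have := @probability_setT _ _ _ P.
  by rewrite O0 measure0 => /eqP; rewrite eq_sym onee_eq0.
pose v0 := cell (z i w0).
(* Positions from [t] on are overwritten by a fixed cell, so the events [W u] partition the space
   according to the first [t] cells only. *)
pose trunc (u : {ffun 'I_M -> V}) : {ffun 'I_M -> V} := [ffun j : 'I_M => if (j < t)%N then u j else v0].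
pose W u := [set w | trunc (cells w) = u].
pose C u := W u `&` [set w | H u (z i w)].
have mW u : measurable (W u) by exact: (measurable_cells [set u' | trunc u' = u]).
have mC u : measurable (C u).
  by apply: measurableI => //; exact: (measurable_funPTI (z i) (mH u)).
have HE : [set w | H (cells w) (z i w)] = \bigcup_(u in [set: {ffun 'I_M -> V}]) C u.
  have HT w : H (trunc (cells w)) = H (cells w).
    by apply: locH => j jt; rewrite ffunE jt.
  apply/seteqP; split=> [w Hw|w [u _ [<-]]] /=; last by rewrite HT.
  by exists (trunc (cells w)) => //; split => //=; rewrite HT.
have finT : finite_set [set: {ffun 'I_M -> V}] by exact: finite_finset.
have mHc : measurable [set w | H (cells w) (z i w)].
  by rewrite HE; exact: fin_bigcup_measurable.
split => //.
have CW u : (P (C u) <= p%:E * P (W u))%E.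
  have [uT|uT] := eqVneq (trunc u) u; last first.
    suff -> : C u = set0 by rewrite measure0 mule_ge0.
    rewrite -subset0 => w [wu _]; case/negP: uT.
    by rewrite -wu; apply/eqP/ffunP => j; rewrite !ffunE; case: (j < t)%N.
  (* As [i] is not in [J], independence over [i |: J] and over [J] shows that [P (C u)] is [P (W u)]
     times the probability for the constant choice [H u]. *)
  pose J := [set j : 'I_M | (j < t)%N]%SET.
  have iJ : i \notin J by rewrite inE -leqNgt.
  pose B j := if j == i then H u else [set l | cell l = u j].
  have mB j : measurable (B j) by rewrite /B; case: eqP.
  have WE : W u = [set w | forall j, j \in J -> B j (z j w)].
    apply/seteqP; split=> [w wu j|w Jw] /=.
      rewrite inE => jt; rewrite /B ifN /= -?wu ?ffunE ?jt ?ffunE//.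
      by apply: contraTneq jt => ->; rewrite -leqNgt.
    rewrite -uT; apply/ffunP => j; rewrite !ffunE; case: ifP => // jt.
    have := Jw j; rewrite inE => /(_ jt); rewrite /B ifN//.
    by apply: contraTneq jt => ->; rewrite -leqNgt.
  have CE : C u = [set w | forall j, j \in (i |: J)%SET -> B j (z j w)].
    rewrite /C WE; apply/seteqP; split=> [w [Jw Hw] j|w Jw] /=.
      rewrite !inE => /predU1P[->|jt]; first by rewrite /B eqxx.
      by apply: Jw; rewrite inE.
    split=> [j jJ|]; first by apply: Jw; rewrite setU1r.
    by have := Jw i; rewrite setU11 /B eqxx; exact.
  rewrite CE WE !z_indep// big_setU1//= {1}/B eqxx.
  rewrite lee_wpmul2r//.
  by apply: prode_ge0 => j _.
rewrite (le_trans (content_sub_fsum P finT (fun u _ => mC u) mHc _))//.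
  by rewrite HE.
apply: (@le_trans _ _ (\sum_(u \in [set: {ffun 'I_M -> V}]) (p%:E * P (W u)))%E).
  by apply: lee_fsum => // u _; exact: CW.
rewrite -ge0_mule_fsumr// -measure_fin_bigcup//; last first.
  by move=> u u' _ _ [w [/= <- <-]].
rewrite -[leRHS]mule1 lee_wpmul2l ?lee_fin// probability_le1//.
exact: fin_bigcup_measurable.
Qed.

End Adaptivity.

Lemma measure_bigsetU_le d (T : measurableType d) (R : realType)
    (mu : {measure set T -> \bar R}) (I : finType) (B : I -> set T) :
  (forall a, measurable (B a)) ->
  (mu (\big[setU/set0]_a B a) <= \sum_a mu (B a))%E.
Proof.
move=> mB; suff [] : measurable (\big[setU/set0]_a B a) /\
  (mu (\big[setU/set0]_a B a) <= \sum_a mu (B a))%E by [].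
elim/big_rec2: _ => [|a x U _ [mU IH]]; first by rewrite measure0.
split; first exact: measurableU.
by rewrite (le_trans (measureU2 _ _ _))// leeD2l.
Qed.

(** With [N = M * K / gamma], the exponent is [256 / 121 * ln N >= 2 * ln N], so the sum is at most
    [M ^ 2 * K / N ^ 2 = gamma ^ 2 / K]. The constant 16 thus absorbs the second factor [M] of the
    union bound. *)
Lemma tail_sum_lt (R : realType) (M K : nat) (alpha gamma delta : R) :
  (0 < M)%N -> (0 < K)%N -> 0 < alpha -> 0 < gamma -> gamma < 1 / 2 ->
  delta = 16 * Num.sqrt (ln (M%:R * K%:R / gamma) / alpha) ->
  (M * M * K)%:R * expR (- (alpha * (delta / 11) ^+ 2)) < gamma.
Proof.
move=> M0 K0 alpha0 gamma0 gamma2 ->.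
have M1 : 1 <= M%:R :> R by rewrite ler1n.
have K1 : 1 <= K%:R :> R by rewrite ler1n.
set N := M%:R * K%:R / gamma.
have N0 : 0 < N by rewrite divr_gt0// mulr_gt0//; lra.
have N1 : 1 <= N.
  rewrite ler_pdivlMr// mul1r (@le_trans _ _ 1)//; first lra.
  exact: mulr_ege1.
have L0 : 0 <= ln N by rewrite ln_ge0.
have -> : alpha * (16 * Num.sqrt (ln N / alpha) / 11) ^+ 2 = 256 / 121 * ln N.
  rewrite 2!exprMn sqr_sqrtr ?divr_ge0 ?(ltW alpha0)//.
  by field; rewrite gt_eqF.
apply: (@le_lt_trans _ _ ((M * M * K)%:R * (N^-1 * N^-1))).
  rewrite ler_wpM2l// -{2 3}(lnK (x := N)) ?posrE// -!expRN -expRD ler_expR; lra.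
have -> : (M * M * K)%:R * (N^-1 * N^-1) = gamma ^+ 2 / K%:R.
  rewrite /N !natrM; field; rewrite !gt_eqF//; lra.
rewrite ltr_pdivrMr; last by lra.
rewrite expr2 ltr_pM2l//; lra.
Qed.

(** A union over rounds [t], indices [i >= t] and batch positions [k]: the lower tail for [i = t],
    the upper tail for [i > t]. Concentration holds on the unit ball, so a query is first divided by
    [Num.max 1 |x|]. *)
Lemma adaptive_queries_bound (R : realType) (E : normedVectType R) d
    (Omega : measurableType d) (P : probability Omega R) (M K : nat)
    (z : 'I_M -> {RV P >-> dual E}) (V : finType) (cell : dual E -> V)
    (Q : {ffun 'I_M -> V} -> nat -> 'I_K -> E) (alpha s : R) :
  (forall v, measurable [set l | cell l = v]) ->
  mutually_independent z ->
  (forall t (u u' : {ffun 'I_M -> V}),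
     (forall j : 'I_M, (j < t)%N -> u j = u' j) -> Q u t = Q u' t) ->
  (forall (i : 'I_M) (x : E) (delta : R), cball 0 1 x -> 0 < delta ->
    (P [set w | (delta <= pairing (z i w) x)%R]
       <= (expR (- (alpha * delta ^+ 2)))%:E)%E /\
    (P [set w | (pairing (z i w) x <= - delta)%R]
       <= (expR (- (alpha * delta ^+ 2)))%:E)%E) ->
  0 < s ->
  exists Bad : set Omega, [/\ measurable Bad,
    (P Bad <= ((M * M * K)%:R * expR (- (alpha * s ^+ 2)))%:E)%E &
    forall w, ~ Bad w -> forall (t : 'I_M) k, let x := Q (cells z cell w) t k in
      - (s * Num.max 1 `|x|) <= pairing (z t w) x /\
      forall i : 'I_M, (t < i)%N -> pairing (z i w) x <= s * Num.max 1 `|x|].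
Proof.
move=> mcell z_indep Qloc conc s0.
have max0 (x : E) : 0 < Num.max 1 `|x| by rewrite lt_max ltr01.
pose H (t i : 'I_M) k u : set (dual E) :=
  let x := Q u t k in
  if i == t then [set l | pairing l x <= - (s * Num.max 1 `|x|)]
  else [set l | s * Num.max 1 `|x| <= pairing l x].
have mH t i k u : measurable (H t i k u).
  rewrite /H; case: ifP => _; set c := s * _.
    have := @measurable_pairing R E (Q u t k) `]-oo, - c] (measurable_itv _).
    by congr measurable; apply/seteqP; split => l /=; rewrite in_itv.
  have := @measurable_pairing R E (Q u t k) `[c, +oo[ (measurable_itv _).
  by congr measurable; apply/seteqP; split => l /=; rewrite in_itv/= andbT.
have PH t i k u : (P [set w | H t i k u (z i w)] <= (expR (- (alpha * s ^+ 2)))%:E)%E.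
  rewrite /H; set x := Q u t k.
  have x1 : cball 0 1 ((Num.max 1 `|x|)^-1 *: x).
    apply/cball0E; rewrite normrZ gtr0_norm ?invr_gt0//.
    by rewrite mulrC ler_pdivrMr// mul1r le_max lexx orbT.
  have [upper lower] := conc i _ _ x1 s0.
  case: ifP => _.
    apply: le_trans lower; rewrite le_eqVlt; apply/orP; left; apply/eqP.
    congr (P _); apply/seteqP; split => w /=;
      by rewrite pairingZr [_^-1 * _]mulrC ler_pdivrMr// mulNr.
  apply: le_trans upper; rewrite le_eqVlt; apply/orP; left; apply/eqP.
  congr (P _); apply/seteqP; split => w /=;
    by rewrite pairingZr [_^-1 * _]mulrC ler_pdivlMr.
pose B (a : 'I_M * 'I_M * 'I_K) : set Omega :=
  if (a.1.1 <= a.1.2)%N then [set w | H a.1.1 a.1.2 a.2 (cells z cell w) (z a.1.2 w)] else set0.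
have BE a : measurable (B a) /\ (P (B a) <= (expR (- (alpha * s ^+ 2)))%:E)%E.
  rewrite /B; case: ifP => [ti|_]; last by rewrite measure0 lee_fin expR_ge0.
  apply: (adaptive_choice_bound mcell z_indep (t := a.1.1) ti (expR_ge0 _) (mH _ _ _) _ (PH _ _ _)).
  by move=> u u' uu'; rewrite /H (Qloc _ _ _ uu').
exists (\big[setU/set0]_a B a); split.
- by apply: bigsetU_measurable => a _; exact: (BE a).1.
- apply: (le_trans (measure_bigsetU_le _ _)); first by move=> a; exact: (BE a).1.
  apply: (@le_trans _ _ (\sum_(a : 'I_M * 'I_M * 'I_K) (expR (- (alpha * s ^+ 2)))%:E)%E).
    by apply: lee_sum => a _; exact: (BE a).2.
  by rewrite sumEFin sumr_const !card_prod !card_ord -[expR _ *+ _]mulr_natl.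
move=> w Bw t k x.
have nB a : ~ B a w.
  by move=> Baw; apply: Bw; rewrite (bigD1 a)//=; left.
split=> [|i ti].
  have := nB (t, t, k); rewrite /B /= leqnn /H eqxx /= => /negP.
  by rewrite -ltNge => /ltW.
have := nB (t, i, k); rewrite /B /= (ltnW ti) /= /H ifN /=.
  by move=> /negP; rewrite -ltNge => /ltW.
by apply: contraTneq ti => ->; rewrite ltnn.
Qed.

(** * The hard distribution and the complexity bound *)

Lemma smoothed_hard_ext (R : realType) (E : normedVectType R) M (mu delta : R) S
    (zeta zeta' : 'I_M -> dual E) m :
  (forall j : 'I_M, (j < m)%N -> zeta j = zeta' j) ->
  smoothed_hard mu delta S zeta m = smoothed_hard mu delta S zeta' m.
Proof.
move=> zz; apply/funext => x; rewrite /smoothed_hard; congr (_ * S _ x).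
by apply/funext => y; rewrite /hard; congr (_ * _); apply: eq_bigr => j /zz ->.
Qed.

Theorem theorem2p2 (R : realType) (E : normedVectType R) (X : set E)
  (X_closed : closed X)
  (X_convex : convex_set (X : set (convex_lmodType E)))
  (X_ball : cball 0 1 `<=` X)
  (K : nat) (K_ge1 : (1 <= K)%N) (kappa : R) (kappa_ge0 : 0 <= kappa)
  (M : nat) (M_gt0 : (0 < M)%N)
  (d : measure_display) (Omega : measurableType d) (P : probability Omega R)
  (z : 'I_M -> {RV P >-> dual E})
  (z_indep : mutually_independent z)
  (z_supp : forall i, {ae P, forall w, (dual_norm (z i w) <= 1%:E)%E})
  (eps alpha gamma : R) (eps_gt0 : 0 < eps) (alpha_gt0 : 0 < alpha)
  (gamma_gt0 : 0 < gamma) (gamma_lt : gamma < 1 / 2)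
  (deltabar : R)
  (deltabarE :
    deltabar = 16 * Num.sqrt (ln (M%:R * K%:R / gamma) / alpha))
  (eta r mu : R)
  (smoothable : locally_smoothable (E := E) kappa eta r mu)
  (mu_gt0 : 0 < mu) (r_gt0 : 0 < r) (r_le : r <= deltabar / 8)
  (eta_le : eta <= eps * mu / 4)
  (min_norm : (P [set w | (ereal_inf
      [set dual_norm (\sum_(i < M) lam i *: z i w)%R | lam in simplex M]
      <= (4 * mu * eps)%:E)%E] <= gamma%:E)%E)
  (concentration : forall (i : 'I_M) (x : E) (delta : R),
    cball 0 1 x -> 0 < delta ->
    (P [set w | (delta <= pairing (z i w) x)%R]
       <= (expR (- (alpha * delta ^+ 2)))%:E)%E /\
    (P [set w | (pairing (z i w) x <= - delta)%R]
       <= (expR (- (alpha * delta ^+ 2)))%:E)%E)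
  (deltabar_le : deltabar <= mu * eps / M%:R)
  (Ans : Type) (O : (E -> R) -> E -> Ans)
  (O_local : local_oracle (smooth_class kappa 1) X O) :
  (M%:R%:E <= Compl_HP (smooth_class kappa 1) X K O (2 * gamma) eps)%E.
Proof.
have [S [S_smooth S_close S_local]] := smoothable.
have delta_gt0 : 0 < deltabar by lra.
have delta_M : deltabar * M%:R <= mu * eps by rewrite -ler_pdivlMr// ltr0n.
(* The tolerance [deltabar / 10] for the representatives splits into [deltabar / 11] for the
   original vectors and [deltabar / 110] for the discretization. *)
have theta_gt0 : 0 < deltabar / 110 by rewrite divr_gt0.
have [V [cell [rep [mcell rep1 rep_close]]]] := dual_ball_discretization E theta_gt0.
pose zeta (u : {ffun 'I_M -> V}) i : dual E := rep (u i).
have zeta1 u i x : `|pairing (zeta u i) x| <= `|x| by exact: rep1.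
pose Fu u : E -> R := smoothed_hard mu deltabar S (zeta u) M.
have Fu_smooth u : smooth_class kappa 1 (Fu u).
  exact/smooth_class_scale/S_smooth/hard_smooth.
pose F := smooth_class (E := E) kappa 1.
pose f (w : Omega) : g_sigma_algebraType (class_sets F) := Fu (cells z cell w).
(* [f] factors through the finitely many cells, so the preimage of any set at all is measurable,
   whatever [S] does. *)
have mf : measurable_fun setT f.
  move=> _ B _; rewrite setTI.
  exact: (measurable_cells z mcell [set u | B (Fu u)]).
pose X_f : {RV P >-> g_sigma_algebraType (class_sets F)} :=
  HB.pack f (isMeasurableFun.Build _ _ _ _ f mf).
pose D : probability (g_sigma_algebraType (class_sets F)) R := distribution P X_f.
have DE B : D B = P [set w | B (f w)] by [].
have DF : distributions D.
  rewrite /distributions /= DE -(@probability_setT _ _ _ P); congr (P _).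
  by apply/seteqP; split => // w _; exact: Fu_smooth.
apply: le_trans (ereal_sup_ubound _); last by exists D.
apply: le_ereal_inf_tmp => _ [A AX <-].
apply: le_ereal_inf_tmp => _ [tau /= + <-]; rewrite lee_fin ler_nat.
apply: contraPT; rewrite -ltnNge => tauM; apply/negP; rewrite -ltNge.
pose Q u t := query O mu deltabar S (zeta u) A t.
have Qloc t (u u' : {ffun 'I_M -> V}) :
    (forall j : 'I_M, (j < t)%N -> u j = u' j) -> Q u t = Q u' t.
  move=> uu'; rewrite /Q /query (@smoothed_hard_ext _ _ _ _ _ _ (zeta u) (zeta u'))// => j jt.
  by rewrite /zeta uu'.
have delta11 : 0 < deltabar / 11 by rewrite divr_gt0.
have [Bq [mBq PBq Bq_good]] :=
  adaptive_queries_bound mcell z_indep Qloc concentration delta11.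
have /choice[N NE] : forall i, exists N : set Omega, [/\ measurable N, P N = 0%E &
    forall w, ~ N w -> (dual_norm (z i w) <= 1%:E)%E].
  move=> i; have [N [mN PN zN]] := z_supp i; exists N; split => // w Nw.
  by apply: contrapT => zw; apply: Nw; exact: zN.
pose Bn := [set w | (ereal_inf [set dual_norm (\sum_(i < M) lam i *: z i w)%R | lam in simplex M]
      <= (4 * mu * eps)%:E)%E].
have mBn : measurable Bn.
  by apply: measurable_ereal_inf_dual_norm => //; rewrite !mulr_ge0// ltW.
pose BN := \big[setU/set0]_i N i.
have mBN : measurable BN by apply: bigsetU_measurable => i _; have [] := NE i.
have PBN : (P BN <= 0)%E.
  apply: (le_trans (measure_bigsetU_le _ _)); first by move=> i; have [] := NE i.
  by rewrite big1// => i _; have [] := NE i.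
pose Bad := BN `|` (Bn `|` Bq).
have mBad : measurable Bad by apply: measurableU => //; exact: measurableU.
(* The support costs 0, the minimal norm at most [gamma] and the queries strictly less than [gamma].
   Strictness matters, as the complexity accepts probability exactly [2 * gamma]. *)
have PBad : (P Bad < (2 * gamma)%:E)%E.
  have tail := tail_sum_lt M_gt0 K_ge1 alpha_gt0 gamma_gt0 gamma_lt deltabarE.
  apply: (@le_lt_trans _ _ (0 + (gamma%:E + ((M * M * K)%:R *
      expR (- (alpha * (deltabar / 11) ^+ 2)))%:E))%E); last first.
    by rewrite add0e -EFinD lte_fin; lra.
  apply: (le_trans (measureU2 _ _ _)) => //; first exact: measurableU.
  apply: leeD => //; apply: (le_trans (measureU2 _ _ _)) => //.
  exact: leeD.
pose good u := (M%:R%:E <= rounds X O A (Fu u) eps)%E.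
have goodP w : ~ Bad w -> good (cells z cell w).
  move=> Badw; set u := cells z cell w.
  have BNw : ~ BN w by move=> ?; apply: Badw; left.
  have Bnw : ~ Bn w by move=> ?; apply: Badw; right; left.
  have Bqw : ~ Bq w by move=> ?; apply: Badw; right; right.
  have z1 i : forall x, `|pairing (z i w) x| <= `|x|.
    apply: dual_norm_le1; have [_ _] := NE i; apply => Niw.
    by apply: BNw; rewrite /BN (bigD1 i)//=; left.
  have close i x : `|pairing (zeta u i) x - pairing (z i w) x| <= deltabar / 110 * `|x|.
    by rewrite /zeta /u ffunE; exact: rep_close.
  have [x0 x01 zx0] : exists2 x, `|x| <= 1 & forall i, pairing (z i w) x < - (4 * mu * eps).
    apply: contrapT => nx; apply: Bnw.
    by apply/ereal_inf_dual_norm_le.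
  have zetax0 i : pairing (zeta u i) x0 <= - (4 * mu * eps) + deltabar / 110.
    have := zx0 i; have := close i x0; rewrite ler_norml => /andP[_].
    have : deltabar / 110 * `|x0| <= deltabar / 110 by rewrite ler_piMr// ltW.
    lra.
  (* A pairing at [x0] is at least [-1], whence [4 * mu * eps <= 1 + deltabar / 110], while
     [deltabar <= mu * eps]. *)
  have delta2 : deltabar <= 2^-1.
    have := zetax0 (Ordinal M_gt0); have := zeta1 u (Ordinal M_gt0) x0.
    rewrite ler_norml => /andP[].
    have : deltabar <= deltabar * M%:R by rewrite ler_peMr ?ler1n// ltW.
    lra.
  have max_le (x : E) : deltabar / 110 * `|x| <= deltabar / 110 * Num.max 1 `|x|.
    by rewrite ler_wpM2l ?(ltW theta_gt0)// le_max lexx orbT.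
  apply: (rounds_smoothed_hard O_local S_smooth S_close S_local mu_gt0 r_gt0 r_le
    (zeta1 u) AX delta2 _ _ eps_gt0 eta_le delta_M X_ball x01 zetax0).
  - move=> t k; have [+ _] := Bq_good w Bqw t k.
    rewrite -/u /Q; set x := query _ _ _ _ _ _ _ _.
    have := close t x; rewrite ler_norml => /andP[+ _]; have := max_le x; lra.
  - move=> t i k ti; have [_ /(_ i ti)] := Bq_good w Bqw t k.
    rewrite -/u /Q; set x := query _ _ _ _ _ _ _ _.
    have := close i x; rewrite ler_norml => /andP[_ +]; have := max_le x; lra.
(* Success before round [M] may be a nonmeasurable event, but it avoids the finite set [G] of
   resisting functions. The complement of [G] is measurable and bounds its outer measure. *)
pose G : set (g_sigma_algebraType (class_sets F)) := \bigcup_(u in good) [set Fu u].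
have mG : measurable G.
  apply: fin_bigcup_measurable => // u _.
  by apply: measurable_convex_singleton; [move=> g []|exact: Fu_smooth].
have DG : (mu_ext D (~` G) < (2 * gamma)%:E)%E.
  rewrite measurable_mu_extE; last exact: measurableC.
  change (P [set w | ~ G (f w)] < (2 * gamma)%:E)%E.
  apply: le_lt_trans PBad; apply: le_measure; rewrite ?inE//.
    exact: (measurable_cells z mcell [set u | ~ G (Fu u)]).
  move=> w /= Gw; apply: contrapT => Badw; apply: Gw.
  by exists (cells z cell w) => //; exact: goodP.
refine (le_lt_trans _ DG).
apply: le_mu_ext => g [_ gtau] [u gu gE]; move: gtau; rewrite gE.
by move=> /(le_trans gu); rewrite lee_fin ler_nat leqNgt tauM.
Qed.
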